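(* Let $X_1,X_2,\dots$ be i.i.d. Bernoulli random variables with $\Pr\{X_i=1\}=1-\Pr\{X_i=0\}=p\in(0,1)$ and let $\widehat{\boldsymbol p}=\frac1n\sum_{i=1}^nX_i$. Let $0<\varepsilon<\frac34$ and $0<\delta<2\exp\!\Big(-\frac{9\ln2}{(3-4\varepsilon)^2}\Big)$. Define $$\zeta=\frac{4C_{\mathrm{BE}}}{\sqrt{\Big[1-\Big(\frac{4\varepsilon}{3}+\sqrt{\frac{\ln2}{\ln\frac2\delta}}\Big)^2\Big]\frac{\ln\frac1\delta}{2\varepsilon^2}}}.$$ Then $\Pr\{|\widehat{\boldsymbol p}-p|<\varepsilon\mid p\}>1-\delta$ for every $p\in(0,1)$, provided that $$n>\frac1{2\varepsilon^2}\ln\frac{1+\zeta}{\delta}.$$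
   Context: $C_{\mathrm{BE}}$ denotes the absolute constant in the Berry–Esseen inequality: for i.i.d. $Y_1,Y_2,\dots$ distributed as $Y$ with $\mathbb{E}[Y]=0$, $\mathbb{E}[Y^2]>0$, $\mathbb{E}[|Y|^3]<\infty$, the cdf $F_n$ of $\sum_{i=1}^nY_i/\sqrt{n\mathbb{E}[Y^2]}$ satisfies $|F_n(y)-\Phi(y)|\le\frac{C_{\mathrm{BE}}}{\sqrt n}\frac{\mathbb{E}[|Y|^3]}{\mathbb{E}^{3/2}[Y^2]}$ for all $y,n$, where $\Phi$ is the standard normal cdf. $\Pr\{\cdot\mid p\}$ denotes probability when the Bernoulli parameter is $p$. *)

(* Defs.v *)
From HB Require Import structures.
From mathcomp Require Import all_boot all_order all_algebra.
From mathcomp Require Import all_classical all_reals all_analysis.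
Set Implicit Arguments. Unset Strict Implicit. Unset Printing Implicit Defensive.
Import Order.TTheory GRing.Theory Num.Theory Num.Def.
Import numFieldNormedType.Exports.
Local Open Scope classical_set_scope.
Local Open Scope ring_scope.

Definition mutually_independent {d} {T : measurableType d} {R : realType}
  (P : probability T R) (X : nat -> {RV P >-> R}) : Prop :=
  forall (I : seq nat) (B : nat -> set R),
    uniq I -> (forall i, measurable (B i)) ->
    P (\big[setI/setT]_(i <- I) (X i @^-1` B i)) =
    (\prod_(i <- I) P (X i @^-1` B i))%E.

Definition identically_distributed {d} {T : measurableType d} {R : realType}
  (P : probability T R) (X : nat -> {RV P >-> R}) : Prop :=
  forall i (B : set R), measurable B -> P (X i @^-1` B) = P (X 0%N @^-1` B).

Definition iid {d} {T : measurableType d} {R : realType}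
  (P : probability T R) (X : nat -> {RV P >-> R}) : Prop :=
  mutually_independent X /\ identically_distributed X.

Definition Phi {R : realType} (y : R) : R :=
  fine (normal_prob 0 1 `]-oo, y]).

Definition BerryEsseen_constant {R : realType} (C : R) : Prop :=
  forall (d : measure_display) (T : measurableType d) (P : probability T R)
         (Y : nat -> {RV P >-> R}),
    iid Y ->
    ('E_P[Y 0%N] = 0)%E ->
    (0 < 'E_P[fun w => (Y 0%N w ^+ 2)%R])%E ->
    ('E_P[fun w => (`|Y 0%N w| ^+ 3)%R] < +oo)%E ->
    forall (n : nat) (y : R), (0 < n)%N ->
      let m2 := fine ('E_P[fun w => (Y 0%N w ^+ 2)%R])%E in
      let m3 := fine ('E_P[fun w => (`|Y 0%N w| ^+ 3)%R])%E in
      let Fn := fine (P [set w | (\sum_(i < n) Y i w) / Num.sqrt (n%:R * m2) <= y]) in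
      `|Fn - Phi y| <= C / Num.sqrt n%:R * (m3 / (Num.sqrt m2) ^+ 3).

Definition zeta {R : realType} (C eps delta : R) : R :=
  4 * C / Num.sqrt ((1 - (4 * eps / 3 + Num.sqrt (ln 2 / ln (2 / delta))) ^+ 2)
                    * (ln (1 / delta) / (2 * eps ^+ 2))).

(* Main.v *)
(* For a threshold z > p, tilting the Bernoulli parameter from p to z bounds the
   upper tail P(X_1 + ... + X_n >= n z | p) by exp(- n KL(z, p)) times the same
   tail under z.  Under z the threshold is the mean, so Berry-Esseen bounds that
   tail by 1/2 + C / sqrt (n z (1 - z)).  With z = p + eps and w = p + eps / 3,
   Massart's inequality gives KL(z, p) >= eps^2 / (2 w (1 - w)), which is at
   least 2 eps^2.  If |2 w - 1| <= sqrt (ln 2 / ln (2 / delta)), then z is far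
   enough from 0 and 1 for the Berry-Esseen term to be at most zeta / 2, and the
   tail is at most (1 + zeta) / 2 * exp(- 2 n eps^2) < delta / 2.  Otherwise
   Massart's exponent alone makes it smaller than delta / 2.  The lower tail
   follows by exchanging 0 and 1.

   Berry-Esseen can only be applied to an actual i.i.d. Bernoulli(z) sequence; it
   is realized on [0, 1[ with Lebesgue measure by iterating the map that
   stretches both [0, z[ and [z, 1[ onto [0, 1[. *)
Require Import Defs.
From HB Require Import structures.
From mathcomp Require Import all_boot all_order all_algebra.
From mathcomp Require Import all_classical all_reals all_analysis.
From mathcomp Require Import measurable_realfun ring lra.
Set Implicit Arguments. Unset Strict Implicit. Unset Printing Implicit Defensive.
Import Order.TTheory GRing.Theory Num.Theory Num.Def.
Import numFieldNormedType.Exports.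
Local Open Scope classical_set_scope.
Local Open Scope ring_scope.

(** * Lebesgue measure on [0, 1[ and the piecewise affine stretching map *)

Lemma lebesgue_measure_affine (R : realType) (c e : R) (A : set (measurableTypeR R)) :
  0 < c -> measurable A ->
  lebesgue_measure ((fun x : R => c * x + e) @^-1` A)
  = (c^-1%:E * lebesgue_measure A)%E.
Proof.
move=> c0 mA; set f : measurableTypeR R -> measurableTypeR R := fun x => c * x + e.
have mf : measurable_fun setT f.
  by apply: measurable_funD => //; exact: measurable_funM.
pose nu := mscale (NngNum (ltW c0)) (pushforward (@lebesgue_measure R) f).
(* Both sides are measures in [A], so it suffices that they agree on half-open intervals. *)
have key : lebesgue_measure A = nu mf A.
  apply: lebesgue_measure_unique => // X [[a b] _ <-] /=.
  change (lebesgue_measure [set` `]a, b]] =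
    (c%:E * lebesgue_measure (f @^-1` [set` `]a, b]]))%E).
  have -> : f @^-1` [set` `]a, b]] = [set` `](a - e) / c, (b - e) / c]].
    apply/seteqP; split => x /=; rewrite !in_itv/= /f ltr_pdivrMr// ler_pdivlMr//
      ltrBlDr lerBrDr (mulrC x) => /andP[-> ->] //.
  rewrite !lebesgue_measure_itv /= !lte_fin ltr_pM2r ?invr_gt0// ltrD2r.
  case: ifPn => _; last by rewrite mule0.
  by rewrite -!EFinB -EFinM; congr EFin; field; rewrite gt_eqF.
by rewrite key /nu /mscale /pushforward /= muleA -EFinM mulVf ?gt_eqF// mul1e.
Qed.

(** The carrier stays the whole line, with mass only on [0, 1[; this avoids a subtype and lets
    [split_map] be defined everywhere. *)
Definition unit_interval_measure (R : realType) : set (measurableTypeR R) -> \bar R :=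
  mrestr (@lebesgue_measure R) (measurable_itv `[0, 1[).

HB.instance Definition _ (R : realType) :=
  Measure.on (@unit_interval_measure R).

Lemma unit_interval_measure_setT (R : realType) :
  unit_interval_measure [set: measurableTypeR R] = 1%E.
Proof.
rewrite /unit_interval_measure /mrestr setTI.
by rewrite lebesgue_measure_itv /= lte_fin ltr01 -EFinB subr0.
Qed.

HB.instance Definition _ (R : realType) :=
  Measure_isProbability.Build _ _ R (@unit_interval_measure R)
    (unit_interval_measure_setT R).

Definition split_map (R : realType) (z : R) (u : measurableTypeR R) : measurableTypeR R :=
  if u < z then u / z else (u - z) / (1 - z).

Lemma measurable_split_map (R : realType) (z : R) :
  measurable_fun [set: measurableTypeR R] (split_map z).
Proof.
apply: measurable_fun_ifT.
- by apply: measurable_fun_ltr => //; exact: measurable_cst.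
- by apply: measurable_funM => //; exact: measurable_cst.
- apply: measurable_funM; last exact: measurable_cst.
  by apply: measurable_funD => //; exact: measurable_cst.
Qed.

(** On [0, z[ the map is a dilation of slope [z^-1] onto [0, 1[, so preimages shrink by the factor
    [z]. *)
Lemma split_map_lt (R : realType) (z : R) (A : set (measurableTypeR R)) :
  0 < z < 1 -> measurable A ->
  unit_interval_measure ([set u | u < z] `&` split_map z @^-1` A)
  = (z%:E * unit_interval_measure A)%E.
Proof.
move=> /andP[z0 z1] mA; rewrite /unit_interval_measure /mrestr.
rewrite -[X in (X%:E * _)%E]invrK.
rewrite -(@lebesgue_measure_affine _ z^-1 0) ?invr_gt0//; last first.
  by apply: measurableI => //; exact: measurable_itv.
congr lebesgue_measure; apply/seteqP; split => u /=;
    rewrite /split_map !in_itv/= addr0 (mulrC z^-1).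
  move=> [[uz]]; rewrite uz => Au /andP[u0 u1]; split => //.
  apply/andP; split; first by rewrite divr_ge0 ?(ltW z0).
  by rewrite ltr_pdivrMr ?mul1r.
move=> [Au /andP[]]; rewrite ltr_pdivrMr// mul1r pmulr_lge0 ?invr_gt0// => u0 uz.
by rewrite uz u0 (lt_trans uz).
Qed.

Lemma split_map_ge (R : realType) (z : R) (A : set (measurableTypeR R)) :
  0 < z < 1 -> measurable A ->
  unit_interval_measure (~` [set u | u < z] `&` split_map z @^-1` A)
  = ((1 - z)%:E * unit_interval_measure A)%E.
Proof.
move=> /andP[z0 z1] mA; rewrite /unit_interval_measure /mrestr.
have z1' : 0 < 1 - z by rewrite subr_gt0.
rewrite -[X in (X%:E * _)%E]invrK.
rewrite -(@lebesgue_measure_affine _ (1 - z)^-1 (- z / (1 - z))) ?invr_gt0//; last first.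
  by apply: measurableI => //; exact: measurable_itv.
congr lebesgue_measure; apply/seteqP; split => u /=;
    rewrite /split_map !in_itv/= (mulrC (1 - z)^-1) -mulrDl.
  move=> [[/negP uz]]; rewrite (negbTE uz) => Au /andP[u0 u1]; split => //.
  have zu : z <= u by rewrite leNgt.
  apply/andP; split; first by rewrite divr_ge0 ?subr_ge0 ?(ltW z1).
  by rewrite ltr_pdivrMr ?mul1r ?ltrD2r.
move=> [Au /andP[]]; rewrite ltr_pdivrMr// mul1r pmulr_lge0 ?invr_gt0//.
rewrite subr_ge0 ltrBlDr subrK => uz u1.
have /negbTE uz' : ~~ (u < z) by rewrite -leNgt.
by rewrite uz' u1 (le_trans (ltW z0) uz).
Qed.

(** * Independence along the orbit of a measure-preserving map *)

Section shift_process.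
Context d (T : measurableType d) (R : realType) (P : probability T R).
Variables (D : set T) (th : T -> T) (z : R).
Hypotheses (mD : measurable D) (mth : measurable_fun setT th).
Hypothesis thD : forall A, measurable A -> P (D `&` th @^-1` A) = (z%:E * P A)%E.
Hypothesis thDC : forall A, measurable A ->
  P (~` D `&` th @^-1` A) = ((1 - z)%:E * P A)%E.

Let mthA A : measurable A -> measurable (th @^-1` A).
Proof. by move=> mA; rewrite -[_ @^-1` _]setTI; exact: mth. Qed.

Lemma shift_PD : P D = z%:E.
Proof. by have := thD measurableT; rewrite preimage_setT setIT probability_setT mule1. Qed.

Lemma shift_preserving A : measurable A -> P (th @^-1` A) = P A.
Proof.
move=> mA; rewrite -[_ @^-1` _]setTI -(setUv D) setIUl measureU.
- rewrite [X in (X + _)%E]thD// [X in (_ + X)%E]thDC//.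
  rewrite -[P A]fineK ?fin_num_measure// -!EFinM -EFinD; congr EFin; ring.
- by apply: measurableI => //; exact: mthA.
- by apply: measurableI; [exact: measurableC|exact: mthA].
- by rewrite setIACA setICr set0I.
Qed.

Lemma measurable_iter_shift i : measurable_fun setT (iter i th).
Proof. by elim: i => [|i IH] /=; [exact: measurable_id|exact: measurableT_comp]. Qed.

Lemma measurable_iter_preimage i A : measurable A -> measurable (iter i th @^-1` A).
Proof. by move=> mA; rewrite -[_ @^-1` _]setTI; exact: measurable_iter_shift. Qed.

Lemma iter_shift_preserving i A : measurable A -> P (iter i th @^-1` A) = P A.
Proof.
move=> mA; elim: i => [//|i IH].
have -> : iter i.+1 th @^-1` A = th @^-1` (iter i th @^-1` A).
  by apply/seteqP; split => w /=; rewrite -iterSr.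
by rewrite shift_preserving ?IH//; exact: measurable_iter_preimage.
Qed.

(** The sigma-algebra generated by [D], listed explicitly. *)
Definition sigmaD (E : set T) := [\/ E = set0, E = setT, E = D | E = ~` D].

Lemma measurable_sigmaD E : sigmaD E -> measurable E.
Proof. by case=> ->//; exact: measurableC. Qed.

Lemma sigmaD_indep E A : sigmaD E -> measurable A ->
  P (E `&` th @^-1` A) = (P E * P A)%E.
Proof.
move=> + mA; case=> ->.
- by rewrite set0I measure0 mul0e.
- by rewrite setTI probability_setT mul1e shift_preserving.
- by rewrite thD// shift_PD.
- by rewrite thDC// probability_setC// shift_PD.
Qed.

(** Induction on [m]: the events after the first form the preimage under [th] of the same
    intersection for the shifted family, and [sigmaD_indep] splits the first one off. *)
Lemma shift_indep (E : nat -> set T) m : (forall i, sigmaD (E i)) ->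
  P (\big[setI/setT]_(i < m) (iter i th @^-1` E i)) = (\prod_(i < m) P (E i))%E.
Proof.
elim: m E => [|m IH] E sE; first by rewrite !big_ord0 probability_setT.
have mE i : measurable (E i) by exact: measurable_sigmaD.
rewrite !big_ord_recl -(IH (fun i => E i.+1))// -sigmaD_indep//; last first.
  by apply: bigsetI_measurable => i _; exact: measurable_iter_preimage.
congr (P (_ `&` _)).
rewrite (big_morph _ (preimage_setI th) (preimage_setT th)).
by apply: eq_bigr => i _; apply/seteqP; split => w /=; rewrite -iterSr.
Qed.

Lemma shift_iid (a b : R) : exists Y : nat -> {RV P >-> R}, iid Y /\
  forall i w, Y i w = if w \in iter i th @^-1` D then a else b.
Proof.
have mY i : measurable_fun setT (fun w => if w \in iter i th @^-1` D then a else b).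
  apply: measurable_fun_ifT; try exact: measurable_cst.
  apply: (@measurable_fun_bool _ _ _ _ true); rewrite setTI.
  rewrite (_ : _ @^-1` _ = iter i th @^-1` D); first exact: measurable_iter_preimage.
  by apply/seteqP; split => w /=; [move=> /set_mem|move=> /mem_set].
pose Y i : {RV P >-> R} := mfun_Sub (mem_set (mY i)).
exists Y; split => //.
(* The set [F B] depends only on which of [a] and [b] lie in [B]; the four cases give the four
   members of [sigmaD]. *)
pose F (B : set R) : set T := [set w | B (if w \in D then a else b)].
have sF B : sigmaD (F B).
  rewrite /sigmaD /F.
  have [Ba|Ba] := pselect (B a); have [Bb|Bb] := pselect (B b).
  - by apply: Or42; apply/seteqP; split => w //= _; case: ifP.
  - apply: Or43; apply/seteqP; split => w /=.
      by case: ifPn => // /set_mem.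
    by move=> wD; rewrite mem_set.
  - apply: Or44; apply/seteqP; split => w /=.
      by case: ifPn => // /negP wD _ /mem_set.
    by move=> wD; rewrite memNset.
  - by apply: Or41; apply/seteqP; split => w //=; case: ifP.
have YF i B : Y i @^-1` B = iter i th @^-1` F B by [].
have PY i B : P (Y i @^-1` B) = P (F B).
  by rewrite YF iter_shift_preserving//; exact: measurable_sigmaD.
split; last by move=> i B mB; rewrite !PY.
move=> I B uI mB.
(* [shift_indep] treats initial segments, so [I] is embedded in one and the added indices receive
   [setT], of probability one. *)
pose m := (\max_(i <- I) i).+1.
have Im i : i \in I -> (i < m)%N by move=> iI; rewrite ltnS; exact: leq_bigmax_seq.
pose E i := if i \in I then F (B i) else setT.
have sE i : sigmaD (E i) by rewrite /E; case: ifP => // _; exact: Or42.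
have reidx (S : Type) (idx : S) (op : Monoid.com_law idx) (G : nat -> S) :
    \big[op/idx]_(i <- I) G i = \big[op/idx]_(i < m) (if val i \in I then G i else idx).
  rewrite -big_mkcond -(big_mkord (fun i => i \in I) G) -[RHS]big_filter.
  apply: perm_big; apply: uniq_perm; rewrite ?filter_uniq ?iota_uniq// => i.
  by rewrite mem_filter mem_index_iota/=; case: (boolP (i \in I)) => //= /Im ->.
rewrite !reidx; transitivity (P (\big[setI/setT]_(i < m) (iter i th @^-1` E i))).
  by congr (P _); apply: eq_bigr => i _; rewrite /E YF; case: ifP.
rewrite shift_indep//; apply: eq_bigr => i _; rewrite /E; case: ifP => _.
  by rewrite PY.
exact: probability_setT.
Qed.

End shift_process.

(** The values [a] and [b] are quantified after the events [D], so that the 0/1 sequence and its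
    centred version can be read off the same events. *)
Lemma bernoulli_process (R : realType) (z : R) : 0 < z < 1 ->
  exists (d : measure_display) (T : measurableType d) (P : probability T R)
    (D : nat -> set T),
    (forall i, measurable (D i) /\ P (D i) = z%:E) /\
    forall a b : R, exists Y : nat -> {RV P >-> R},
      iid Y /\ forall i w, Y i w = if w \in D i then a else b.
Proof.
move=> z01.
have mD : measurable [set u : measurableTypeR R | u < z].
  by rewrite -[X in measurable X]/([set u : R | u \in `]-oo, z[]); exact: measurable_itv.
have mth := measurable_split_map z.
pose P : probability (measurableTypeR R) R := @unit_interval_measure R.
exists _, (measurableTypeR R), P.
exists (fun i => iter i (split_map z) @^-1` [set u | u < z]); split.
  move=> i; split; first exact: measurable_iter_preimage.
  rewrite (iter_shift_preserving (z := z) mD mth) => //.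
  - apply: (shift_PD (th := split_map z)) => A mA; exact: split_map_lt.
  - by move=> A mA; exact: split_map_lt.
  - by move=> A mA; exact: split_map_ge.
move=> a b; apply: (shift_iid (z := z) mD mth) => A mA.
  exact: split_map_lt.
exact: split_map_ge.
Qed.

(** * Massart's lower bound on the Kullback-Leibler divergence *)

Definition KL (R : realType) (z p : R) : R :=
  z * (ln z - ln p) + (1 - z) * (ln (1 - z) - ln (1 - p)).

(** Convexity of the inverse, made explicit: the gap to the tangent at [w] is a square over a
    positive quantity. *)
Lemma inv_ge_tangent (R : realType) (x w : R) : 0 < x -> 0 < w ->
  w^-1 - (x - w) / w ^+ 2 <= x^-1.
Proof.
move=> x0 w0; rewrite -subr_ge0.
have -> : x^-1 - (w^-1 - (x - w) / w ^+ 2) = (x - w) ^+ 2 / (x * w ^+ 2).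
  by field; rewrite !gt_eqF.
by rewrite divr_ge0 ?sqr_ge0// mulr_ge0 ?sqr_ge0// ltW.
Qed.

(* [KL z p] is the integral of [(z - x) / (x (1 - x))] over [[p, z]]; bounding
   the convex function [1 / (x (1 - x))] below by its tangent at the barycenter
   [w] of the weight [z - x] amounts to Jensen's inequality.  At [z = 1] the
   second term of [KL] vanishes, whatever the value of [ln 0]. *)
Lemma KL_ge (R : realType) (z p : R) : 0 < p -> p < z -> z <= 1 ->
  (z - p) ^+ 2 / (2 * ((p + (z - p) / 3) * (1 - (p + (z - p) / 3)))) <= KL z p.
Proof.
move=> p0 pz z1; set w := p + (z - p) / 3.
have w0 : 0 < w by rewrite /w; lra.
have w1 : 0 < 1 - w by rewrite /w; lra.
(* [g] and [g'] are the value and the slope of 1 / (x (1 - x)) at [w]; [Q] is an antiderivative of z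
   - x times this tangent. *)
pose g := (w * (1 - w))^-1.
pose g' := ((1 - w) ^+ 2)^-1 - (w ^+ 2)^-1.
pose A := z * (g - g' * w).
pose B := (z * g' - g + g' * w) / 2.
pose Q : {poly R} := A *: 'X + B *: 'X^2 - (g' / 3) *: 'X^3.
pose L1 : R -> R := @ln R \o (fun x => 1 - x).
(* [H p - H z] equals [KL z p - (Q.[z] - Q.[p])], so it is enough that [H] does not increase. *)
pose H : R -> R := - (z \*: @ln R) - ((1 - z) \*: L1) + horner Q.
have QE x : Q.[x] = A * x + B * x ^+ 2 - g' / 3 * x ^+ 3 by rewrite /Q !hornerE.
have Q'E x : (deriv Q).[x] = (z - x) * (g + g' * (x - w)).
  rewrite /Q !poly.derivE !hornerE /A /B /=; field; do ?split; rewrite gt_eqF.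
have HE y : H y = - (z * ln y) - (1 - z) * ln (1 - y) + Q.[y] by [].
have dL1 (x : R) : x < 1 -> is_derive x (1:R) L1 (- (1 - x)^-1).
  move=> x1; have x1' : 0 < 1 - x by lra.
  have D0 : is_derive x (1:R) (fun y : R => 1 - y) (0 - 1 : R) by exact: is_deriveB.
  have D1 := is_derive1_ln x1'.
  by have := @is_derive1_comp R _ (fun y : R => 1 - y) x _ _ D1 D0; rewrite sub0r mulrN1.
have dH (x : R) : x \in `]p, z[ -> is_derive x (1 : R) H
   (- (z / x) + (1 - z) / (1 - x) + (z - x) * (g + g' * (x - w))).
  rewrite in_itv/= => /andP[px xz].
  have x0 : 0 < x by lra.
  have D1 := is_derive1_ln x0.
  have D2 := dL1 x ltac:(lra).
  have D3 := is_deriveB (is_deriveN (is_deriveZ z D1)) (is_deriveZ (1 - z) D2).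
  have D4 := is_derive_poly Q x.
  have D := is_deriveD D3 D4.
  apply: (is_derive_eq D).
  by rewrite Q'E /GRing.scale/= mulrN opprK.
have H'le (x : R) : x \in `]p, z[ -> derive1 H x <= 0.
  move=> xI; rewrite derive1E (@derive_val _ _ _ _ _ _ _ (dH _ xI)).
  move: xI; rewrite in_itv/= => /andP[px xz].
  have x0 : 0 < x by lra.
  have x1 : 0 < 1 - x by lra.
  (* Since 1 / (x (1 - x)) = 1 / x + 1 / (1 - x), the derivative splits into two tangent gaps, at
     [w] and at [1 - w]. *)
  have -> : - (z / x) + (1 - z) / (1 - x) + (z - x) * (g + g' * (x - w)) =
    - ((z - x) * ((x^-1 - (w^-1 - (x - w) / w ^+ 2))
         + ((1 - x)^-1 - ((1 - w)^-1 - ((1 - x) - (1 - w)) / (1 - w) ^+ 2)))).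
    by rewrite /g /g'; field; rewrite !gt_eqF.
  rewrite oppr_le0; apply: mulr_ge0; first by rewrite subr_ge0 ltW.
  by apply: addr_ge0; rewrite subr_ge0; exact: inv_ge_tangent.
have cH : {within `[p, z], continuous H}.
  apply: continuous_in_subspaceT => x; rewrite inE/= in_itv/= => /andP[px xz].
  have x0 : 0 < x by lra.
  apply: continuousD; last exact: continuous_horner.
  apply: continuousB.
    apply: continuousN; apply: continuousZr; exact: continuous_ln.
  (* At [z = 1] the logarithm of 1 - x blows up at the right endpoint, but its coefficient is
     zero. *)
  have [z1'|z1'] := eqVneq z 1.
    have -> : (1 - z) \*: L1 = cst (0 : R).
      by apply/funext => y /=; rewrite z1' subrr scale0r.
    exact: cst_continuous.
  have x1 : x < 1 by rewrite (le_lt_trans xz)// lt_neqAle z1'.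
  apply: continuousZr.
  apply: differentiable_continuous; apply/derivable1_diffP.
  by have D := dL1 _ x1; exact: ex_derive.
have Hle : H z <= H p.
  apply: (ler0_derive1_le_cc _ H'le cH) => //; last exact: ltW.
  - by move=> x /dH D; exact: ex_derive.
  - by rewrite in_itv/= lexx ltW.
  - by rewrite in_itv/= lexx ltW.
(* The slope [g'] drops out: x - w has integral zero against the weight z - x on [p, z], because [w]
   is the barycenter. *)
have Qzp : Q.[z] - Q.[p] = (z - p) ^+ 2 / (2 * (w * (1 - w))).
  have -> : (z - p) ^+ 2 / (2 * (w * (1 - w))) = (z - p) ^+ 2 / 2 * g.
    by rewrite invfM mulrA.
  by rewrite !QE /A /B; clear - z p w g g'; generalize g g' => a b; rewrite /w; field.
rewrite -Qzp /KL; move: Hle; rewrite !HE; lra.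
Qed.

(** * Probabilities of events about Bernoulli sums as finite sums *)

Section disjoint_cover.
Context d (T : measurableType d) (R : realType) (P : probability T R).
Variables (I : finType) (E : I -> set T).
Hypothesis mE : forall i, measurable (E i).
Hypothesis dE : forall i j, i != j -> E i `&` E j = set0.

Lemma probability_disjoint_union (q : pred I) :
  P (\big[setU/set0]_(i | q i) E i) = (\sum_(i | q i) P (E i))%E.
Proof.
elim: (index_enum I) (index_enum_uniq I) => [|i s IH] /=.
  by rewrite !big_nil measure0.
move=> /andP[si us]; rewrite !big_cons; case: ifP => qi; last exact: IH.
have mU : measurable (\big[setU/set0]_(j <- s | q j) E j).
  by apply: bigsetU_measurable => j _; exact: mE.
rewrite measureU//; first by congr (_ + _)%E; exact: IH.
rewrite big_seq_cond; elim/big_ind: _ => [|U V EU EV|j /andP[js _]].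
- exact: setI0.
- by rewrite setIUr EU EV setU0.
- by apply: dE; apply: contraNneq si => ->.
Qed.

(** The [E i] may miss a null set. Those inside [A] bound [P A] from below, the others bound the
    probability of its complement; the two bounds add up to one, so both are equalities. *)
Lemma probability_by_cases (q : pred I) (A : set T) : measurable A ->
  (\sum_i P (E i) = 1)%E ->
  (forall i w, E i w -> (w \in A) = q i) -> P A = (\sum_(i | q i) P (E i))%E.
Proof.
move=> mA sE qA.
have le_part (r : pred I) (B : set T) : measurable B ->
    (forall i, r i -> E i `<=` B) -> (\sum_(i | r i) P (E i) <= P B)%E.
  move=> mB rB; rewrite -probability_disjoint_union; apply: le_measure.
  - by rewrite inE; exact: bigsetU_measurable.
  - by rewrite inE.
  - by elim/big_ind: _ => // U V ? ?; rewrite subUset.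
have h1 := le_part q A mA (fun i qi w Ew => set_mem (etrans (qA i w Ew) qi)).
have h2 : (\sum_(i | ~~ q i) P (E i) <= P (~` A))%E.
  apply: le_part; first exact: measurableC.
  by move=> i qi w Ew Aw; move: qi; rewrite -(qA _ _ Ew) mem_set.
move: sE h1 h2; rewrite probability_setC// (bigID q)/=.
have fP (r : pred I) : (\sum_(i | r i) P (E i))%E \is a fin_num.
  by apply/sum_fin_numP => i _ _; exact: fin_num_measure.
have fA : P A \is a fin_num by exact: fin_num_measure.
rewrite -(fineK (fP q)) -(fineK (fP (fun i => ~~ q i))) -(fineK fA).
rewrite -EFinD -EFinB !lee_fin => -[] e1 h1 h2; congr EFin.
by apply/eqP; rewrite eq_le h1 andbT; lra.
Qed.

End disjoint_cover.

Definition weight (R : pzRingType) n (p : R) (b : {ffun 'I_n -> bool}) : R :=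
  \prod_i (if b i then p else 1 - p).

Lemma weight_ge0 (R : realType) n (p : R) (b : {ffun 'I_n -> bool}) :
  0 <= p <= 1 -> 0 <= weight p b.
Proof.
by move=> /andP[p0 p1]; apply: prodr_ge0 => i _; case: ifP; rewrite ?subr_ge0.
Qed.

Lemma sum_weight (R : realType) n (p : R) :
  \sum_(b : {ffun 'I_n -> bool}) weight p b = 1.
Proof.
rewrite /weight -(bigA_distr_bigA (fun (i : 'I_n) (c : bool) => if c then p else 1 - p)).
by rewrite big1// => i _; rewrite big_bool /= addrC subrK.
Qed.

(** The right side no longer mentions the probability space, so an estimate proved on the
    constructed space applies to any Bernoulli sequence. *)
Lemma bernoulli_sum (d : measure_display) (T : measurableType d) (R : realType)
    (P : probability T R) (X : nat -> {RV P >-> R}) (p : R) (n : nat) (q : pred R) :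
  mutually_independent X ->
  (forall i, P (X i @^-1` [set 1]) = p%:E /\ P (X i @^-1` [set 0]) = (1 - p)%:E) ->
  measurable [set w | q (\sum_(i < n) X i w)] ->
  P [set w | q (\sum_(i < n) X i w)] =
  (\sum_(b : {ffun 'I_n -> bool} | q (\sum_i (b i)%:R)) weight p b)%:E.
Proof.
move=> indX pX mA.
pose E (b : {ffun 'I_n -> bool}) := \big[setI/setT]_(i < n) X i @^-1` [set (b i)%:R].
have EP b w : E b w <-> forall i : 'I_n, X i w = (b i)%:R.
  rewrite /E; split.
    by move=> + i; rewrite (bigD1 i)//= => -[].
  by move=> h; elim/big_ind: _ => // i _; exact: h.
have mX i (B : set R) : measurable B -> measurable (X i @^-1` B).
  by move=> mB; rewrite -[_ @^-1` _]setTI; exact: measurable_funP.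
have mE b : measurable (E b).
  by apply: bigsetI_measurable => i _; apply: mX; exact: measurable_set1.
have dE b c : b != c -> E b `&` E c = set0.
  move=> bc; apply/seteqP; split => w // -[/EP hb /EP hc].
  case/eqP: bc; apply/ffunP => i; have := hb i; rewrite hc => /eqP.
  by rewrite eqr_nat; case: (b i); case: (c i).
have PE b : P (E b) = (weight p b)%:E.
  (* Independence is stated for families indexed by all naturals; indices from [n] on get [setT]. *)
  pose B k : set R := if insub k is Some i then [set (b i)%:R] else setT.
  have := indX (index_iota 0 n) B (iota_uniq _ _) _.
  rewrite !big_mkord => h.
  rewrite /E /weight -prodEFin; under eq_bigr => i _.
    rewrite (_ : [set (b i)%:R] = B i); last by rewrite /B valK.
    over.
  rewrite h; last by move=> k; rewrite /B; case: insubP => // *; exact: measurable_set1.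
  apply: eq_bigr => i _; rewrite /B valK; have [p1 p0] := pX i.
  by case: (b i).
rewrite (probability_by_cases mE dE (q := fun b => q (\sum_i (b i)%:R)))//.
- by rewrite -sumEFin; apply: eq_bigr => b _; rewrite PE.
- by under eq_bigr do rewrite PE; rewrite sumEFin sum_weight.
- move=> b w /EP h; apply/idP/idP.
    by move=> /set_mem/=; under eq_bigr do rewrite h.
  by move=> qb; apply/mem_set => /=; under eq_bigr do rewrite h.
Qed.

(** * Binomial tails and tilting of the parameter *)

Definition binomial_tail (R : realType) n (p z : R) : R :=
  \sum_(b : {ffun 'I_n -> bool} | n%:R * z <= \sum_i (b i)%:R) weight p b.

Lemma binomial_tail_le1 (R : realType) n (p z : R) : 0 <= p <= 1 ->
  binomial_tail n p z <= 1.
Proof.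
move=> p01; rewrite -(sum_weight n p) /binomial_tail [leRHS](bigID
  (fun b : {ffun 'I_n -> bool} => n%:R * z <= \sum_i (b i)%:R))/=.
by rewrite lerDl sumr_ge0// => b _; exact: weight_ge0.
Qed.

(** Negating every outcome exchanges successes and failures. *)
Lemma binomial_tail_flip (R : realType) n (p z : R) :
  \sum_(b : {ffun 'I_n -> bool} | \sum_i (b i)%:R <= n%:R * z) weight p b =
  binomial_tail n (1 - p) (1 - z).
Proof.
pose flip (b : {ffun 'I_n -> bool}) := [ffun i => ~~ b i].
have flipK : involutive flip by move=> b; apply/ffunP => i; rewrite !ffunE negbK.
rewrite /binomial_tail (reindex_inj (inv_inj flipK)); apply: eq_big => b.
  have -> : \sum_i (flip b i)%:R = n%:R - \sum_i (b i)%:R :> R.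
    rewrite -[n in n%:R - _]card_ord -sumr_const -sumrB; apply: eq_bigr => i _.
    by rewrite ffunE; case: (b i); rewrite ?subrr ?subr0.
  by apply/idP/idP; lra.
by move=> _; apply: eq_bigr => i _; rewrite ffunE if_neg subKr.
Qed.

(** With k successes the likelihood ratio is exp (k e1 + (n - k) e0). It decreases in k when e1 <= 0
    <= e0, and at k = n z it equals exp (- n KL). *)
Lemma weight_tilt (R : realType) n (p z : R) (b : {ffun 'I_n -> bool}) :
  0 < p -> p < z -> z <= 1 -> n%:R * z <= \sum_i (b i)%:R ->
  weight p b <= expR (- (n%:R * KL z p)) * weight z b.
Proof.
move=> p0 pz z1 hb.
have z0 : 0 < z by lra.
have p1 : 0 < 1 - p by lra.
have hn : \sum_i (1 - (b i)%:R) = n%:R - \sum_i (b i)%:R :> R.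
  by rewrite sumrB sumr_const card_ord.
have hn0 : 0 <= \sum_i (1 - (b i)%:R) :> R.
  by apply: sumr_ge0 => i _; case: (b i); rewrite ?subrr ?subr0.
pose e1 := ln p - ln z; pose e0 := ln (1 - p) - ln (1 - z).
(* An outcome containing a failure cannot reach the threshold [n] of the case [z = 1], so
   [ln (1 - z)] is a genuine logarithm whenever it matters. *)
have zb i : ~~ b i -> z < 1.
  move=> bi; rewrite lt_neqAle z1 andbT; apply/eqP => zE.
  have : (1 : R) <= \sum_i (1 - (b i)%:R).
    rewrite (bigD1 i)//= (negbTE bi) subr0 lerDl.
    by apply: sumr_ge0 => j _; case: (b j); rewrite ?subrr ?subr0.
  by rewrite hn; move: hb; rewrite zE; lra.
have factor i : (if b i then p else 1 - p) =
    expR ((b i)%:R * e1 + (1 - (b i)%:R) * e0) * (if b i then z else 1 - z).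
  have := zb i; case: (b i) => /= [_|/(_ isT) z1'].
    by rewrite mul1r subrr mul0r addr0 expRD expRN !lnK ?posrE// divfK// gt_eqF.
  have z1'' : 0 < 1 - z by rewrite subr_gt0.
  by rewrite mul0r subr0 mul1r add0r expRD expRN !lnK ?posrE// divfK// gt_eqF.
have -> : weight p b =
    expR ((\sum_i (b i)%:R) * e1 + (\sum_i (1 - (b i)%:R)) * e0) * weight z b.
  rewrite !mulr_suml -big_split/= expR_sum /weight -big_split/=.
  by apply: eq_bigr => i _; exact: factor.
apply: ler_wpM2r; first by apply: weight_ge0; rewrite ltW//=.
rewrite ler_expR hn.
have e1_le0 : e1 <= 0 by rewrite subr_le0 ler_ln ?posrE// ltW.
set k := \sum_i _ in hb hn hn0 *; set N := n%:R in hb hn hn0 *.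
have -> : - (N * KL z p) = N * z * e1 + N * (1 - z) * e0 by rewrite /KL /e1 /e0; ring.
rewrite -subr_ge0.
have -> : N * z * e1 + N * (1 - z) * e0 - (k * e1 + (N - k) * e0) = (k - N * z) * (e0 - e1) by ring.
have [zE|zN] := eqVneq z 1.
  have -> : k - N * z = 0 by rewrite zE; rewrite zE in hb; rewrite hn in hn0; lra.
  by rewrite mul0r.
have z1' : z < 1 by rewrite lt_neqAle zN.
have e0_ge0 : 0 <= e0 by rewrite subr_ge0 ler_ln ?posrE ?subr_gt0//; lra.
by apply: mulr_ge0; lra.
Qed.

Lemma binomial_tail_tilt (R : realType) n (p z : R) : 0 < p -> p < z -> z <= 1 ->
  binomial_tail n p z <= expR (- (n%:R * KL z p)) * binomial_tail n z z.
Proof.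
move=> p0 pz z1; rewrite /binomial_tail mulr_sumr.
by apply: ler_sum => b hb; exact: weight_tilt.
Qed.

Lemma binomial_tail_gt1 (R : realType) n (p z : R) : (0 < n)%N -> 1 < z ->
  binomial_tail n p z = 0.
Proof.
move=> n0 z1; rewrite /binomial_tail big_pred0// => b; apply/negbTE; rewrite -ltNge.
apply: (@le_lt_trans _ _ n%:R); last by rewrite ltr_pMr// ltr0n.
rewrite -[n in leRHS]card_ord -sumr_const; apply: ler_sum => i _.
by case: (b i); rewrite ?ler01.
Qed.

(** * Berry-Esseen for Bernoulli variables *)

Lemma Phi0 (R : realType) : Phi (0 : R) = 2^-1.
Proof.
pose f : R -> R := normal_pdf 0 1.
have fE x : f x = f (- x).
  rewrite /f normal_pdfE ?oner_neq0// /normal_fun.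
  by rewrite !subr0 sqrrN.
have f0 x : 0 <= f x by exact: normal_pdf_ge0.
have cf : continuous f by apply: continuous_normal_pdf; rewrite oner_neq0.
have mf : measurable_fun setT f by exact: measurable_normal_pdf.
(* The density is even, so each half-line carries half of the total mass. *)
have I2 := ge0_symfun_integralT f0 cf fE.
rewrite integral_normal_pdf -set_itvcy in I2.
have PhiE : normal_prob 0 1 `]-oo, (0:R)] =
    (\int[lebesgue_measure]_(x in `[0%R, +oo[) (f x)%:E)%E.
  rewrite /normal_prob -/f -[in LHS]oppr0 ge0_integration_by_substitutionNy//.
  - by apply: eq_integral => x _; congr EFin; rewrite [RHS]fE.
  - exact: continuous_subspaceT.
rewrite /Phi PhiE.
have : (\int[lebesgue_measure]_(x in `[0%R, +oo[) (f x)%:E)%E \is a fin_num.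
  rewrite -PhiE; exact: fin_num_measure.
move: I2; case: (integral _ _ _) => //= r [] h _; lra.
Qed.

Lemma expectation_two_valued (d : measure_display) (T : measurableType d) (R : realType)
    (P : probability T R) (D : set T) (z a b : R) (f : T -> R) :
  measurable D -> P D = z%:E -> (forall w, f w = if w \in D then a else b) ->
  ('E_P[f] = (a * z + b * (1 - z))%:E)%E.
Proof.
move=> mD PD fE; have {fE} -> : f = (fun w => if w \in D then a else b) by apply/funext.
have mDC : measurable (~` D) by exact: measurableC.
rewrite unlock -(setUv D) integral_setU//.
- rewrite (_ : (\int[P]_(x in D) _ = \int[P]_(x in D) (cst a%:E) x)%E); last first.
    by apply: eq_integral => x xD; rewrite xD.
  rewrite (_ : (\int[P]_(x in ~` D) _ = \int[P]_(x in ~` D) (cst b%:E) x)%E); last first.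
    by apply: eq_integral => x; rewrite in_setC => /negbTE ->.
  rewrite !integral_cst//; transitivity (a%:E * P D + b%:E * P (~` D))%E => //.
  by rewrite probability_setC// PD -EFinB -!EFinM -EFinD.
- rewrite setUv; apply/measurable_EFinP; apply: measurable_fun_ifT; try exact: measurable_cst.
  apply: (@measurable_fun_bool _ _ _ _ true); rewrite setTI.
  rewrite (_ : _ @^-1` _ = D)//.
  by apply/seteqP; split => w /=; [move=> /set_mem|move=> wD; rewrite mem_set].
- exact/disj_setPCl.
Qed.

Section Berry_Esseen_Bernoulli.
Context (R : realType) (C : R) (hC : BerryEsseen_constant C).

Lemma Berry_Esseen_binomial_tail (n : nat) (z : R) : (0 < n)%N -> 0 < z < 1 ->
  `|binomial_tail n z z - 2^-1| <=
  C / Num.sqrt n%:R * ((z ^+ 2 + (1 - z) ^+ 2) / Num.sqrt (z * (1 - z))).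
Proof.
move=> n0 z01; have /andP[z0 z1] := z01.
have [d [T [P [D [hD /[dup] hY /(_ 1 0) [X [[indX _] XE]]]]]]] := bernoulli_process z01.
(* [Y] is the centred variable with reversed sign, so its distribution function at 0 is the closed
   upper tail of the sum of the [X i]. *)
have [Y [iidY YE]] := hY (z - 1) z.
have YX i w : Y i w = z - X i w by rewrite YE XE; case: ifP; rewrite ?subr0.
have [mD0 PD0] := hD 0%N.
have E1 : ('E_P[Y 0%N] = 0)%E.
  by rewrite (expectation_two_valued mD0 PD0 (YE 0%N)); congr EFin; ring.
have E2 : ('E_P[fun w => (Y 0%N w ^+ 2)%R] = (z * (1 - z))%:E)%E.
  rewrite (expectation_two_valued (a := (z - 1) ^+ 2) (b := z ^+ 2) mD0 PD0).
    by congr EFin; ring.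
  by move=> w; rewrite YE; case: ifP.
have E3 : ('E_P[fun w => (`|Y 0%N w| ^+ 3)%R] =
    (z * (1 - z) * (z ^+ 2 + (1 - z) ^+ 2))%:E)%E.
  rewrite (expectation_two_valued (a := (1 - z) ^+ 3) (b := z ^+ 3) mD0 PD0).
    by congr EFin; ring.
  by move=> w; rewrite YE; case: ifP => _; rewrite ?(gtr0_norm z0)// distrC gtr0_norm ?subr_gt0.
have v0 : 0 < z * (1 - z) by rewrite mulr_gt0 ?subr_gt0.
have := hC iidY E1; rewrite E2 E3 lte_fin v0 ltry => /(_ isT isT n 0 n0) /=.
rewrite Phi0.
have s0 : 0 < Num.sqrt (n%:R * (z * (1 - z))) by rewrite sqrtr_gt0 mulr_gt0// ltr0n.
have -> : [set w | (\sum_(i < n) Y i w) / Num.sqrt (n%:R * (z * (1 - z))) <= 0] =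
          [set w | n%:R * z <= \sum_(i < n) X i w].
  have YXn w : \sum_(i < n) Y i w = n%:R * z - \sum_(i < n) X i w.
    under eq_bigr do rewrite YX.
    by rewrite sumrB sumr_const card_ord mulr_natl.
  by apply/seteqP; split => w /=; rewrite YXn pmulr_lle0 ?invr_gt0// subr_le0.
have PX : forall i, P (X i @^-1` [set 1]) = z%:E /\ P (X i @^-1` [set 0]) = (1 - z)%:E.
  move=> i; have [mDi PDi] := hD i; split.
    rewrite -PDi; congr (P _); apply/seteqP; split => w /=; rewrite XE.
      by case: ifPn => [/set_mem//|_ /esym/eqP]; rewrite oner_eq0.
    by move=> wD; rewrite mem_set.
  rewrite EFinB -PDi -probability_setC//; congr (P _).
  apply/seteqP; split => w /=; rewrite XE.
    by case: ifPn => [_ /eqP|]; rewrite ?oner_eq0//= => /negP wD _ /mem_set.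
  by move=> wD; rewrite memNset.
rewrite (bernoulli_sum (q := fun s => n%:R * z <= s) indX PX) /=; last first.
  rewrite -[X in measurable X]setTI.
  have mS : measurable_fun setT (fun w => \sum_(i < n) X i w) by exact: measurable_sum.
  by apply: (measurable_fun_ler (measurable_cst _) mS) => //; exact: (measurable_set1 true).
rewrite -/(binomial_tail n z z) => /le_trans; apply.
rewrite le_eqVlt; apply/orP; left; apply/eqP; congr (_ * _).
have q0 : 0 < Num.sqrt (z * (1 - z)) by rewrite sqrtr_gt0.
rewrite -[X in X * (z ^+ 2 + _)](sqr_sqrtr (ltW v0)).
by set s := Num.sqrt _ in q0 *; field; rewrite gt_eqF.
Qed.

(** One toss of a fair coin suffices: there [C] times a positive number bounds an absolute value.
    This yields [0 <= zeta]. *)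
Lemma BerryEsseen_constant_ge0 : 0 <= C.
Proof.
have h01 : 0 < (2^-1 : R) < 1 by lra.
have := Berry_Esseen_binomial_tail (ltn0Sn 0) h01.
move=> /(le_trans (normr_ge0 _)); rewrite sqrtr1 divr1 pmulr_lge0//.
rewrite divr_gt0// ?sqrtr_gt0; lra.
Qed.

End Berry_Esseen_Bernoulli.

(** * The one-sided bound and the two-sided estimate *)

Lemma binomial_tail_lt (R : realType) (C eps delta : R) (n : nat) (p : R) :
  BerryEsseen_constant C -> 0 < eps -> eps < 3 / 4 -> 0 < delta ->
  delta < 2 * expR (- (9 * ln 2 / (3 - 4 * eps) ^+ 2)) ->
  (2 * eps ^+ 2)^-1 * ln ((1 + zeta C eps delta) / delta) < n%:R ->
  0 < p < 1 -> binomial_tail n p (p + eps) < delta / 2.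
Proof.
move=> hC e0 e34 d0 dlt hn /andP[p0 p1].
have C0 := BerryEsseen_constant_ge0 hC.
pose L := ln (1 / delta); pose M := ln (2 / delta).
have ln2 : 0 < ln (2 : R) by rewrite ln_gt0// ltr1n.
have LE : L = - ln delta by rewrite /L div1r lnV ?posrE.
have ME : M = ln 2 + L by rewrite /M LE ln_div ?posrE// ltr0n.
have e34' : 0 < 3 - 4 * eps by lra.
have Mlt : 9 * ln 2 / (3 - 4 * eps) ^+ 2 < M.
  move: dlt; rewrite -[X in X < _](lnK (d0 : delta \is Num.pos)).
  rewrite -[X in _ < X * _](lnK (ltr0n R 2 : (2 : R) \is Num.pos)) -expRD ltr_expR ME LE; lra.
(* From [0 < 3 - 4 * eps < 3] the lower bound on [M] is at least [ln 2], whence [delta < 1]. *)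
have L0 : 0 < L.
  suff : ln 2 <= 9 * ln 2 / (3 - 4 * eps) ^+ 2 by rewrite ME in Mlt; lra.
  by rewrite ler_pdivlMr ?exprn_gt0// mulrC ler_wpM2r ?ltW//; nra.
have M0 : 0 < M by rewrite ME addr_gt0.
pose a := Num.sqrt (ln 2 / M).
have a0 : 0 <= a by exact: sqrtr_ge0.
have a2 : a ^+ 2 = ln 2 / M by rewrite sqr_sqrtr// divr_ge0// ltW.
(* The upper bound on [delta] in another form; it makes the radicand in [zeta] positive. *)
have alt : a < 1 - 4 * eps / 3.
  have h : 0 <= 1 - 4 * eps / 3 by lra.
  rewrite -(ltr_pXn2r (n := 2))// a2 ltr_pdivrMr//.
  move: Mlt; rewrite ltr_pdivrMr ?exprn_gt0//.
  have -> : (3 - 4 * eps) ^+ 2 = 9 * (1 - 4 * eps / 3) ^+ 2 by field.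
  lra.
pose b := 4 * eps / 3 + a.
have b01 : 0 < b < 1 by rewrite /b; lra.
pose Br := 1 - b ^+ 2.
have Br0 : 0 < Br by rewrite subr_gt0 expr_lt1//; case/andP: b01 => /ltW.
have V0 : 0 < Br * (L / (2 * eps ^+ 2)) by rewrite mulr_gt0// divr_gt0// mulr_gt0// exprn_gt0.
have zE : zeta C eps delta = 4 * C / Num.sqrt (Br * (L / (2 * eps ^+ 2))) by [].
have z0 : 0 <= zeta C eps delta by rewrite zE divr_ge0 ?sqrtr_ge0// mulr_ge0.
set zt := zeta C eps delta in hn zE z0.
have e2 : 0 < 2 * eps ^+ 2 by rewrite mulr_gt0// exprn_gt0.
have hn1 : ln ((1 + zt) / delta) < 2 * eps ^+ 2 * n%:R.
  by rewrite -ltr_pdivrMl.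
(* The weaker bound without [zeta], for comparing [n] with the radicand and for the case of large
   [|2 w - 1|]. *)
have nL : L < 2 * eps ^+ 2 * n%:R.
  apply: le_lt_trans hn1; rewrite /L ler_ln ?posrE ?divr_gt0//; last lra.
  by rewrite ler_pM2r ?invr_gt0//; lra.
have hn2 : (1 + zt) * expR (- (2 * eps ^+ 2 * n%:R)) < delta.
  rewrite expRN ltr_pdivrMr ?expR_gt0// mulrC -ltr_pdivrMr//.
  by rewrite -[X in X < _](@lnK R) ?posrE ?divr_gt0 ?ltr_expR//; lra.
have n0 : (0 < n)%N.
  by rewrite lt0n; apply/eqP => nE; move: nL; rewrite nE mulr0; lra.
have n0R : 0 < n%:R :> R by rewrite ltr0n.
pose z := p + eps; rewrite -/z.
have [z1|z1] := ltP 1 z; first by rewrite binomial_tail_gt1// divr_gt0.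
have pz : p < z by rewrite /z; lra.
have zgt0 : 0 < z by lra.
have tilt := binomial_tail_tilt n p0 pz z1.
have := KL_ge p0 pz z1.
have -> : z - p = eps by rewrite /z; ring.
set w := p + eps / 3 => hKL.
have w0 : 0 < w by rewrite /w; lra.
have w1 : w < 1 by rewrite /w; move: z1; rewrite /z; lra.
have ww : 0 < w * (1 - w) by rewrite mulr_gt0// subr_gt0.
have ww2 : 0 < 2 * (w * (1 - w)) by exact: mulr_gt0.
(* The cut [a] is where L / (4 w (1 - w)), a lower bound for Massart's exponent by [nL], equals
   [M]. *)
have [wa|wa] := leP `|2 * w - 1| a.
  move: wa; rewrite ler_norml => /andP[wa1 wa2].
  have z1' : z < 1 by move: wa2 alt; rewrite /w /z; lra.
  have zz : 0 < z * (1 - z) by rewrite mulr_gt0// subr_gt0.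
  (* As z = w + 2 eps / 3, the bound [a] on |2 w - 1| becomes the bound [b] on |2 z - 1|. *)
  have zzBr : Br <= 4 * (z * (1 - z)).
    have h1 : - b <= 2 * z - 1 <= b by move: wa1 wa2; rewrite /b /w /z; lra.
    rewrite /Br; nra.
  (* Here z^2 + (1 - z)^2 <= 1, and 4 n z (1 - z) is at least the radicand in [zeta], so the error
     is at most [zt / 2]. *)
  have hBE : binomial_tail n z z <= (1 + zt) / 2.
    have := Berry_Esseen_binomial_tail hC n0 (introT andP (conj zgt0 z1')).
    rewrite ler_norml => /andP[_]; set t := binomial_tail _ _ _ => ht.
    suff : C / Num.sqrt n%:R * ((z ^+ 2 + (1 - z) ^+ 2) / Num.sqrt (z * (1 - z))) <= zt / 2 by lra.
    have -> : C / Num.sqrt n%:R * ((z ^+ 2 + (1 - z) ^+ 2) / Num.sqrt (z * (1 - z))) =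
        (z ^+ 2 + (1 - z) ^+ 2) * C / Num.sqrt (n%:R * (z * (1 - z))).
      by rewrite [Num.sqrt (n%:R * _)]sqrtrM ?ler0n// invfM; ring.
    have -> : zt / 2 = C / (Num.sqrt (Br * (L / (2 * eps ^+ 2))) / 2).
      by rewrite zE; field; rewrite gt_eqF// sqrtr_gt0.
    apply: ler_pM.
    - by rewrite mulr_ge0// addr_ge0// sqr_ge0.
    - by rewrite invr_ge0 sqrtr_ge0.
    - by rewrite ler_piMl//; nra.
    - have s1 : 0 < Num.sqrt (Br * (L / (2 * eps ^+ 2))) / 2 by rewrite divr_gt0 ?sqrtr_gt0.
      have s2 : 0 < Num.sqrt (n%:R * (z * (1 - z))) by rewrite sqrtr_gt0 (mulr_gt0 n0R).
      rewrite lef_pV2 ?posrE//.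
      rewrite ler_pdivrMr// [leRHS]mulrC.
      have <- : Num.sqrt (2 ^+ 2 * (n%:R * (z * (1 - z)))) = 2 * Num.sqrt (n%:R * (z * (1 - z))).
        by rewrite [LHS]sqrtrM ?sqr_ge0// sqrtr_sqr ger0_norm.
      rewrite ler_sqrt; last by rewrite mulr_ge0 ?sqr_ge0// mulr_ge0 ?ler0n// ltW.
      have h1 : L / (2 * eps ^+ 2) <= n%:R by rewrite ler_pdivrMr// mulrC ltW.
      have -> : 2 ^+ 2 * (n%:R * (z * (1 - z))) = 4 * (z * (1 - z)) * n%:R by ring.
      by apply: ler_pM => //; rewrite ltW// divr_gt0.
  apply: (le_lt_trans tilt).
  (* Massart's bound together with w (1 - w) <= 1/4. *)
  have hexp : expR (- (n%:R * KL z p)) <= expR (- (2 * eps ^+ 2 * n%:R)).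
    rewrite ler_expR lerN2 mulrC ler_wpM2l ?ler0n//.
    apply: le_trans hKL; rewrite ler_pdivlMr//.
    have h1 : 0 <= 1 - 4 * (w * (1 - w)).
      by rewrite (_ : _ - _ = (2 * w - 1) ^+ 2) ?sqr_ge0//; ring.
    have := mulr_ge0 (sqr_ge0 eps) h1; lra.
  apply: (@le_lt_trans _ _ (expR (- (2 * eps ^+ 2 * n%:R)) * ((1 + zt) / 2))).
    apply: ler_pM; rewrite ?expR_ge0//.
    by apply: sumr_ge0 => c _; apply: weight_ge0; rewrite !ltW.
  lra.
apply: (le_lt_trans tilt).
have -> : delta / 2 = expR (- M).
  by rewrite /M expRN lnK ?posrE ?divr_gt0// invf_div.
apply: (@le_lt_trans _ _ (expR (- (n%:R * KL z p)))).
  by rewrite ler_piMr ?expR_ge0// binomial_tail_le1// ltW.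
rewrite ltr_expR ltrN2.
have hw : 4 * (w * (1 - w)) * M < L.
  have : a ^+ 2 < (2 * w - 1) ^+ 2 by rewrite -(real_normK (num_real (2 * w - 1))) ltr_pXn2r.
  rewrite a2 ltr_pdivrMr//.
  have -> : (2 * w - 1) ^+ 2 = 1 - 4 * (w * (1 - w)) by ring.
  rewrite ME; lra.
apply: (@lt_le_trans _ _ (n%:R * (eps ^+ 2 / (2 * (w * (1 - w)))))).
  rewrite mulrA ltr_pdivlMr//; lra.
by rewrite ler_pM2l.
Qed.

Theorem theorem4 (R : realType) (C_BE : R) (hC : BerryEsseen_constant C_BE)
  (eps delta : R) (heps0 : 0 < eps) (heps1 : eps < 3 / 4)
  (hdelta0 : 0 < delta)
  (hdelta1 : delta < 2 * expR (- (9 * ln 2 / (3 - 4 * eps) ^+ 2)))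
  (n : nat)
  (hn : (2 * eps ^+ 2)^-1 * ln ((1 + zeta C_BE eps delta) / delta) < n%:R) :
  forall (d : measure_display) (T : measurableType d) (P : probability T R)
         (X : nat -> {RV P >-> R}) (p : R),
    0 < p -> p < 1 ->
    iid X ->
    (forall i, P (X i @^-1` [set 1]) = p%:E /\
               P (X i @^-1` [set 0]) = (1 - p)%:E) ->
    ((1 - delta)%:E <
       P [set w | (`|(\sum_(i < n) X i w) / n%:R - p| < eps)%R])%E.
Proof.
move=> d T P X p p0 p1 [indX _] pX.
(* For [n = 0] the tail condition reads 0 <= 0 and the tail is 1, against a bound
   [delta / 2 < 1]. *)
have n0 : (0 < n)%N.
  rewrite lt0n; apply/eqP => nE.
  have := binomial_tail_lt hC heps0 heps1 hdelta0 hdelta1 hn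
    (introT andP (conj p0 p1)).
  rewrite /binomial_tail nE (eq_bigl xpredT) ?sum_weight; last first.
    by move=> b; rewrite big_ord0 mul0r lexx.
  have : expR (- (9 * ln 2 / (3 - 4 * eps) ^+ 2)) <= 1.
    by rewrite -[leRHS]expR0 ler_expR oppr_le0 divr_ge0 ?sqr_ge0// mulr_ge0// ltW// ln_gt0 ?ltr1n.
  by move: hdelta1; lra.
rewrite (bernoulli_sum (q := fun s => `|s / n%:R - p| < eps) indX pX); last first.
  rewrite -[X in measurable X]setTI.
  have mS : measurable_fun setT (fun w => `|(\sum_(i < n) X i w) / n%:R - p|).
    apply: measurableT_comp => //; apply: measurable_funB => //.
    by apply: measurable_funM => //; exact: measurable_sum.
  by apply: (measurable_fun_ltr mS (measurable_cst _)) => //; exact: (measurable_set1 true).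
rewrite lte_fin.
have up : binomial_tail n p (p + eps) < delta / 2.
  by apply: (binomial_tail_lt hC heps0 heps1 hdelta0 hdelta1 hn); rewrite p0.
have lo : binomial_tail n (1 - p) (1 - p + eps) < delta / 2.
  by apply: (binomial_tail_lt hC heps0 heps1 hdelta0 hdelta1 hn); lra.
have := sum_weight n p.
rewrite (bigID (fun b : {ffun 'I_n -> bool} => `|(\sum_i (b i)%:R) / n%:R - p| < eps))/=.
set s1 := \sum_(_ | _) _; set s2 := \sum_(_ | _) _ => s12.
(* Union bound: an outcome with deviation at least [eps] lies in one of the two closed tails, the
   lower one being an upper tail for failures. *)
suff : s2 <= binomial_tail n p (p + eps) + binomial_tail n (1 - p) (1 - p + eps) by lra.
have -> : 1 - p + eps = 1 - (p - eps) by ring.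
rewrite -binomial_tail_flip /s2 /binomial_tail.
rewrite big_mkcond [X in _ <= X + _]big_mkcond [X in _ <= _ + X]big_mkcond -big_split/=.
apply: ler_sum => b _.
have w0 : 0 <= weight p b by apply: weight_ge0; rewrite !ltW.
case: ifPn => [|_]; last by rewrite addr_ge0//; case: ifP.
have n0R : 0 < n%:R :> R by rewrite ltr0n.
have if_ge0 (c : bool) : 0 <= (if c then weight p b else 0) by case: c.
rewrite -leNgt ler_normr => /orP[] h.
  have -> : n%:R * (p + eps) <= \sum_i (b i)%:R by rewrite mulrC -ler_pdivlMr//; lra.
  by rewrite lerDl if_ge0.
have -> : \sum_i (b i)%:R <= n%:R * (p - eps) by rewrite mulrC -ler_pdivrMr//; lra.
by rewrite lerDr if_ge0.
Qed.
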